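(* Consider the setting, data and standing assumptions described in the context, with $(x^\star,u^\star,g^\star)$ a triple as in standing assumption 3. Let $\alpha=\min\{\frac1\lambda,\frac{1}{2\gamma}\}$, and let $(x^k,u^k)_{k\in\mathbb{N}}$, with $x^k\in\mathcal{X}$ and $u^k\in\mathbb{R}^{n|\mathcal{E}|}$, be a trajectory of the algorithm $$w^k=L_d(\mathcal{G})x^k+E_s(\mathcal{G})u^k,$$ $$x^{k+1}=\operatorname{argmin}_{x\in\mathcal{X}}\ \alpha f(x)+\alpha\langle w^k,x\rangle+B_\psi(x,x^k),$$ $$u^{k+1}=u^k+\alpha E_s(\mathcal{G})^\top x^{k+1}.$$ Then for every $K\in\mathbb{N}$, $$\ell(\overline{x}^K)-\ell(x^\star)+\frac14\langle L_d(\mathcal{G})\overline{x}^K,\overline{x}^K\rangle\le\frac{V(x^1,u^1)}{\alpha K},$$ where $\overline{x}^K=\frac1K\sum_{k=1}^Kx^{k+1}$.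
   Context: Notation. $\mathbb{N}$ is the set of positive integers, $\langle u,v\rangle=u^\top v$, $\|\cdot\|_2$ is the Euclidean norm, $\otimes$ the Kronecker product, $I_n$ the $n\times n$ identity. $\mathcal{G}=(\mathcal{V},\mathcal{E})$ is an undirected graph; fixing an arbitrary orientation, $E(\mathcal{G})$ is its $|\mathcal{V}|\times|\mathcal{E}|$ incidence matrix: in the column of an edge, the entry is $1$ in the row of the head, $-1$ in the row of the tail, and $0$ otherwise. For weights $s,d\in\mathbb{R}^{|\mathcal{E}|}$ define $E_s(\mathcal{G})=(E(\mathcal{G})\operatorname{diag}(\sqrt{s}))\otimes I_n$ (element-wise square root) and $L_d(\mathcal{G})=(E(\mathcal{G})\operatorname{diag}(d)E(\mathcal{G})^\top)\otimes I_n$. Vectors $x=[x_1^\top,\ldots,x_{|\mathcal{V}|}^\top]^\top$ have blocks $x_i\in\mathbb{R}^n$; $\mathcal{X}=\mathcal{X}_0^{|\mathcal{V}|}$ is the Cartesian product of $|\mathcal{V}|$ copies of $\mathcal{X}_0\subset\mathbb{R}^n$; $f(x)=\sum_{i\in\mathcal{V}}f_i(x_i)$ and $\psi(x)=\sum_{i\in\mathcal{V}}\psi_0(x_i)$. A vector $g$ is a subgradient of a convex function $h$ at $x$ if $h(x')-h(x)\ge\langle x'-x,g\rangle$ for all $x'$ in the domain of $h$; $\partial h(x)$ is the set of subgradients at $x$. The normal cone is $N_{\mathcal{X}}(x)=\{g\mid\langle g,x'-x\rangle\le0\ \forall x'\in\mathcal{X}\}$. The Bregman divergence is $B_\psi(x',x)=\psi(x')-\psi(x)-\langle\nabla\psi(x),x'-x\rangle$.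 Standing assumptions. 1. $\mathcal{G}$ is undirected and connected; $s,d\in\mathbb{R}^{|\mathcal{E}|}$ are element-wise strictly positive. $\gamma$ is defined by $\frac1\gamma=\max\{\alpha\mid\alpha s-d\le0\}$ (element-wise inequality), and $\lambda$ is the largest eigenvalue of $L_d(\mathcal{G})$. 2. $\mathcal{X}_0\subset\mathbb{R}^n$ is closed and convex; $\psi_0:\mathcal{X}_0\to\mathbb{R}$ is continuously differentiable and $1$-strongly convex, i.e. $\psi_0-\frac12\|\cdot\|_2^2$ is convex. 3. Each $f_i:\mathcal{X}_0\to\mathbb{R}$ is a proper closed convex function. There exist $x^\star$, $u^\star\in\mathbb{R}^{n|\mathcal{E}|}$ and $g^\star\in\partial f(x^\star)$ such that $E_s(\mathcal{G})^\top x^\star=0$, $x^\star\in\mathcal{X}$, and $-g^\star-E_s(\mathcal{G})u^\star\in N_{\mathcal{X}}(x^\star)$. For such a triple, define $V(x,u)=B_\psi(x^\star,x)+\frac12\|u-u^\star\|_2^2$ and $\ell(x)=f(x)+\langle E_s(\mathcal{G})u^\star,x\rangle$. *)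

(* Defs.v *)
From HB Require Import structures.
From mathcomp Require Import all_boot all_order all_algebra.
From mathcomp Require Import mxtens.
From mathcomp Require Import all_classical all_reals all_analysis.

Set Implicit Arguments.
Unset Strict Implicit.
Unset Printing Implicit Defensive.

Import Order.TTheory GRing.Theory Num.Theory.
Import numFieldNormedType.Exports.

Local Open Scope classical_set_scope.
Local Open Scope ring_scope.

Definition is_max (R : realType) (A : set R) (m : R) : Prop :=
  A m /\ ubound A m.

Definition is_argmin (R : realType) (T : Type) (A : set T) (h : T -> R)
    (m : T) : Prop :=
  A m /\ forall z, A z -> h m <= h z.

Section Euclidean.
Variables (R : realType) (p : nat).
Implicit Types (D : set 'cV[R]_p) (h : 'cV[R]_p -> R) (x g : 'cV[R]_p).

Definition dot x g : R := (x^T *m g) 0 0.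

(* The library norm on matrices is the sup norm, hence this definition. *)
Definition norm2 x : R := Num.sqrt (dot x x).

(* A function defined on a subset D only is represented by a total function
   together with D; the notions below use its values on D only. *)

Definition subdifferential D h x : set 'cV[R]_p :=
  [set g | forall x', D x' -> dot (x' - x) g <= h x' - h x].

Definition normal_cone D x : set 'cV[R]_p :=
  [set g | forall x', D x' -> dot g (x' - x) <= 0].

(* Properness of a real-valued function amounts to a nonempty domain. *)
Definition proper_closed_convex D h : Prop :=
  [/\ D !=set0, convex_function D h &
      closed [set q : 'cV[R]_p * R | D q.1 /\ h q.1 <= q.2]].

Definition strongly_convex1 D h : Prop :=
  convex_function D (fun x => h x - 2^-1 * norm2 x ^+ 2).

(* First-order expansion along D, as D may have empty interior or x may be a
   boundary point; at an interior point of D this is the Frechet gradient. *)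
Definition is_gradient D h x g : Prop :=
  (h y - h x - dot g (y - x)) / norm2 (y - x) @[y --> within D x^'] --> (0 : R).

Definition continuously_differentiable D h : Prop :=
  exists G : 'cV[R]_p -> 'cV[R]_p,
    (forall x, D x -> is_gradient D h x (G x)) /\ {within D, continuous G}.

(* Gradients along D need not be unique, but for D convex and x, x' in D any
   two of them have the same inner product with x' - x, so that the choice is
   immaterial in [bregman D h x' x]. *)
Definition gradient D h x : 'cV[R]_p := xget 0 [set g | is_gradient D h x g].

Definition bregman D h x' x : R := h x' - h x - dot (gradient D h x) (x' - x).

End Euclidean.

Record sgraph (N : nat) := SGraph {
  edges : {set {set 'I_N}};
  edges_card2 : forall e, e \in edges -> #|e| = 2%N
}.

Section Graph.
Variables (N : nat) (G : sgraph N).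

Definition adj : rel 'I_N := fun i j => [set i; j]%SET \in edges G.

Definition connected_graph : Prop := forall i j : 'I_N, connect adj i j.

(* An orientation is given by the head of each edge; the tail is the other
   endpoint. *)
Definition is_orientation (head : {set 'I_N} -> 'I_N) : Prop :=
  forall e, e \in edges G -> head e \in e.

Definition incidence (R : realType) (head : {set 'I_N} -> 'I_N) :
    'M[R]_(N, #|edges G|) :=
  \matrix_(i, k) let e : {set 'I_N} := enum_val k in
    if i == head e then 1 else if i \in e then -1 else 0.

Definition Es (R : realType) (head : {set 'I_N} -> 'I_N) (n : nat)
    (s : 'rV[R]_#|edges G|) : 'M[R]_(N * n, #|edges G| * n) :=
  (incidence R head *m diag_mx (map_mx Num.sqrt s)) *t (1%:M : 'M[R]_n).

Definition Ld (R : realType) (head : {set 'I_N} -> 'I_N) (n : nat)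
    (d : 'rV[R]_#|edges G|) : 'M[R]_(N * n) :=
  (incidence R head *m diag_mx d *m (incidence R head)^T) *t (1%:M : 'M[R]_n).

End Graph.

Section Blocks.
Variables (R : realType) (N n : nat).

Definition block (x : 'cV[R]_(N * n)) (i : 'I_N) : 'cV[R]_n :=
  \col_j x (mxtens_index (i, j)) 0.

Definition power_set (X0 : set 'cV[R]_n) : set 'cV[R]_(N * n) :=
  [set x | forall i, X0 (block x i)].

Definition separable_sum (f : 'I_N -> 'cV[R]_n -> R) (x : 'cV[R]_(N * n)) : R :=
  \sum_(i < N) f i (block x i).

End Blocks.

Section Algorithm.
Variables (R : realType) (P Q : nat).
Variables (X : set 'cV[R]_P) (f psi : 'cV[R]_P -> R).
Variables (L : 'M[R]_P) (E : 'M[R]_(P, Q)).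

(* Iterations are numbered from 1; the terms of index 0 are unconstrained. *)
Definition is_trajectory (alpha : R) (x : nat -> 'cV[R]_P)
    (u : nat -> 'cV[R]_Q) : Prop :=
  forall k, (1 <= k)%N ->
    let w := L *m x k + E *m u k in
    [/\ X (x k),
        is_argmin X
          (fun z => alpha * f z + alpha * dot w z + bregman X psi z (x k))
          (x k.+1) &
        u k.+1 = u k + alpha *: (E^T *m x k.+1)].

Definition lyapunov (xs : 'cV[R]_P) (us : 'cV[R]_Q) (x : 'cV[R]_P)
    (u : 'cV[R]_Q) : R :=
  bregman X psi xs x + 2^-1 * norm2 (u - us) ^+ 2.

Definition ell (us : 'cV[R]_Q) (x : 'cV[R]_P) : R := f x + dot (E *m us) x.

Definition average (x : nat -> 'cV[R]_P) (K : nat) : 'cV[R]_P :=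
  K%:R^-1 *: \sum_(1 <= k < K.+1) x k.+1.

End Algorithm.

(* Main.v *)
Require Import Defs.
From mathcomp Require Import all_boot all_order all_algebra.
From mathcomp Require Import mxtens ring lra.
From mathcomp Require Import all_classical all_reals all_analysis.
Import Order.TTheory GRing.Theory Num.Theory.
Import numFieldNormedType.Exports.
Local Open Scope classical_set_scope.
Local Open Scope ring_scope.

Set Implicit Arguments.
Unset Strict Implicit.

(** The Lyapunov function [V] pays for the gap at every iteration: each step
    lowers [V] by at least [alpha] times [ell x - ell xs + 1/4 <L x, x>] at the
    new primal point ([gap_descent]). Summing telescopes, [V] is nonnegative,
    and the gap is convex, so Jensen's inequality ([convex_average]) bounds the
    gap at the average by [V / (alpha K)] ([primal_dual_rate]).

    One step goes as follows, with [x1] the new primal point and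
    [y = E^T x1]. The three-point inequality for the Bregman proximal step
    ([argmin_three_point]), tested at [xs], bounds [alpha (f x1 - f xs)] by the
    decrease of [B(xs, .)], minus [B(x1, x)], minus
    [alpha <L x + E u, x1 - xs>]. As [E^T xs = 0] and [L xs = 0], the last
    term is [alpha (<L x, x1> + <u, y>)]. Since the dual step is
    [u1 = u + alpha y], the product [alpha <u - us, y>] is the increase of
    [1/2 |u - us|^2] minus [alpha^2/2 |y|^2]; here [<us, y>] is the linear term
    of [ell]. By polarization,
    [- <L x, x1> = 1/2 (<L(x1 - x), x1 - x> - <L x, x> - <L x1, x1>)].
    What remains is absorbed by the two halves of the step size rule:
    [alpha <= 1/lambda] and strong convexity of [psi] give
    [alpha/2 <L(x1 - x), x1 - x> <= 1/2 |x1 - x|^2 <= B(x1, x)], while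
    [alpha <= 1/(2 gamma)] gives
    [alpha^2/2 |y|^2 <= alpha/4 <L x1, x1>].

    For the graph operators, [L = E W E^T] with [W] the diagonal matrix of the
    ratios [d/s] ([Ld_factor]): hence [L] is symmetric, vanishes on the kernel
    of [E^T], and dominates [1/gamma E E^T], as [1/gamma] bounds the ratios
    from below. That [L] is dominated by [lambda] needs an eigenvalue which
    bounds the Rayleigh quotient; it is obtained in [rayleigh_eigenvalue]
    without diagonalizing, as the supremum of that quotient. *)

(** * Inner product on column vectors *)

Section InnerProduct.
Context {R : realType} {p : nat}.
Implicit Types (x y z : 'cV[R]_p) (a : R).

Lemma dotE x y : dot x y = \sum_i x i 0 * y i 0.
Proof. by rewrite /dot mxE; apply: eq_bigr => i _; rewrite mxE. Qed.

Lemma dotC x y : dot x y = dot y x.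
Proof. by rewrite !dotE; apply: eq_bigr => i _; rewrite mulrC. Qed.

Lemma dotDl x y z : dot (x + y) z = dot x z + dot y z.
Proof. by rewrite /dot linearD mulmxDl mxE. Qed.

Lemma dotZl a x y : dot (a *: x) y = a * dot x y.
Proof. by rewrite /dot linearZ -scalemxAl mxE. Qed.

Lemma dotDr x y z : dot x (y + z) = dot x y + dot x z.
Proof. by rewrite dotC dotDl !(dotC x). Qed.

Lemma dotZr a x y : dot x (a *: y) = a * dot x y.
Proof. by rewrite dotC dotZl dotC. Qed.

Lemma dotNl x y : dot (- x) y = - dot x y.
Proof. by rewrite -scaleN1r dotZl mulN1r. Qed.

Lemma dotNr x y : dot x (- y) = - dot x y.
Proof. by rewrite dotC dotNl dotC. Qed.

Lemma dot0l x : dot 0 x = 0.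
Proof. by rewrite -(scale0r 0) dotZl mul0r. Qed.

Definition dot_simp := (dotDl, dotDr, dotNl, dotNr, dotZl, dotZr).

Lemma dotxx_ge0 x : 0 <= dot x x.
Proof. by rewrite dotE sumr_ge0 // => i _; rewrite -expr2 sqr_ge0. Qed.

Lemma dotxx_gt0 x : x != 0 -> 0 < dot x x.
Proof.
move=> x0; rewrite lt_neqAle dotxx_ge0 andbT eq_sym.
apply: contra x0; rewrite dotE psumr_eq0 => [/allP x0|i _]; last first.
  by rewrite -expr2 sqr_ge0.
apply/eqP/matrixP => i j; rewrite ord1 mxE.
by have := x0 i (mem_index_enum i); rewrite /= mulf_eq0 orbb => /eqP.
Qed.

Lemma norm2_sq x : norm2 x ^+ 2 = dot x x.
Proof. by rewrite sqr_sqrtr // dotxx_ge0. Qed.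

Lemma norm2_ge0 x : 0 <= norm2 x.
Proof. exact: sqrtr_ge0. Qed.

Lemma norm2Z a x : 0 <= a -> norm2 (a *: x) = a * norm2 x.
Proof.
by move=> a0; rewrite /norm2 !dot_simp mulrA -expr2 sqrtrM ?sqr_ge0 // sqrtr_sqr
  ger0_norm.
Qed.

Lemma norm2_gt0 x : x != 0 -> 0 < norm2 x.
Proof. by move=> x0; rewrite sqrtr_gt0 dotxx_gt0. Qed.

Lemma le_coord_norm2 x i : `|x i 0| <= norm2 x.
Proof.
rewrite -sqrtr_sqr ler_wsqrtr // dotE (bigD1 i) //= -expr2 lerDl.
by rewrite sumr_ge0 // => j _; rewrite -expr2 sqr_ge0.
Qed.

Lemma ball_norm2 x y r : norm2 (y - x) < r -> ball x r y.
Proof.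
move=> lt_r; split=> [|i j]; first exact: le_lt_trans (norm2_ge0 _) lt_r.
rewrite -ball_normE /= distrC ord1; apply: le_lt_trans lt_r.
by have := le_coord_norm2 (y - x) i; rewrite !mxE.
Qed.

End InnerProduct.

Lemma dot_mulmx {R : realType} {p q : nat} (A : 'M[R]_(q, p))
    (x : 'cV[R]_p) (y : 'cV[R]_q) :
  dot (A *m x) y = dot x (A^T *m y).
Proof. by rewrite /dot trmx_mul mulmxA. Qed.

(** * Convexity along segments *)

Section Convexity.
Context {R : realType} {p : nat}.
Implicit Types (D : set 'cV[R]_p) (h : 'cV[R]_p -> R).
Implicit Types (x y g : 'cV[R]_p) (t : R).

(** Here and in [convex_functionP], segments are parametrized by the step from
    [x] towards [y], the form in which directional derivatives use them. *)
Lemma convex_setP D : convex_set D <->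
  forall x y t, D x -> D y -> 0 <= t <= 1 -> D (x + t *: (y - x)).
Proof.
split=> [cD x y t Dx Dy /andP[t0 t1]|cD x y t].
  have := cD y x (Itv01 t0 t1); rewrite !inE => /(_ Dy Dx).
  rewrite /conv /= /unstable.onem scalerBl scale1r scalerBr.
  by rewrite addrC -addrA [- _ + _]addrC.
rewrite !inE => Dx Dy.
have := cD y x t%:num Dy Dx; rewrite ge0 le1 => /(_ isT).
rewrite /conv /= /unstable.onem scalerBl scale1r scalerBr.
by rewrite [in X in _ -> X]addrC -addrA [- _ + _]addrC.
Qed.

Lemma convex_functionP D h : convex_function D h <->
  forall x y t, D x -> D y -> 0 <= t <= 1 ->
    h (x + t *: (y - x)) <= h x + t * (h y - h x).
Proof.
have cvE (x y : 'cV[R]_p) t : x + t *: (y - x) = t *: y + (1 - t) *: x.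
  by rewrite scalerBl scale1r scalerBr addrCA.
split=> [ch x y t Dx Dy /andP[t0 t1]|ch t x y].
  have := ch (Itv01 t0 t1) y x; rewrite !inE => /(_ Dy Dx).
  rewrite /conv /= /unstable.onem -cvE => /le_trans; apply.
  rewrite /conv /= /unstable.onem /GRing.scale /=; lra.
rewrite !inE => Dx Dy.
have := ch y x t%:num Dy Dx; rewrite ge0 le1 => /(_ isT).
rewrite cvE => /le_trans; apply.
rewrite convRE /unstable.onem; lra.
Qed.

(** Jensen's inequality for the running average: the average of [K + 1] points
    is the point at parameter [1/(K + 1)] of the segment from the average of
    the first [K] to the last one. The shift of the index is the one of
    [average], which collects the outputs of the first [K] iterations. *)
Lemma convex_average D h (x : nat -> 'cV[R]_p) (K : nat) :
  convex_set D -> convex_function D h -> (forall k, (1 <= k)%N -> D (x k.+1)) ->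
  (1 <= K)%N ->
  D (average x K) /\
  h (average x K) <= K%:R^-1 * \sum_(1 <= k < K.+1) h (x k.+1).
Proof.
move=> /convex_setP cD /convex_functionP ch Dx.
case: K => // K _; elim: K => [|K [IHD IHh]].
  by rewrite /average !big_nat1 invr1 scale1r mul1r; split=> //; exact: Dx.
have K0 : (K.+1%:R : R) \is a GRing.unit by rewrite unitfE pnatr_eq0.
have K1 : (K.+2%:R : R) \is a GRing.unit by rewrite unitfE pnatr_eq0.
have KE : (K.+2%:R : R) = K.+1%:R + 1 by rewrite -natr1.
have t01 : 0 <= (K.+2%:R : R)^-1 <= 1.
  by rewrite invr_ge0 ler0n /= invf_le1 ?ltr0n // ler1n.
have avgE : average x K.+2
    = average x K.+1 + K.+2%:R^-1 *: (x K.+3 - average x K.+1).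
  have sumE m : \sum_(1 <= k < m.+2) x k.+1 = m.+1%:R *: average x m.+1.
    by rewrite scalerA divrr ?unitfE ?pnatr_eq0 // scale1r.
  rewrite [LHS]/average big_nat_recr //= sumE.
  move: (average x K.+1) (x K.+3) => v z.
  have K_neq0 : K.+2%:R != 0 :> R by rewrite pnatr_eq0.
  apply: (scalerI K_neq0); rewrite [RHS]scalerDr !scalerA divrr // !scale1r KE.
  by rewrite scalerDl scale1r -addrA [v + _]addrC subrK.
split; first by rewrite avgE; apply: cD => //; exact: Dx.
rewrite avgE; apply: le_trans (ch _ _ _ IHD _ t01) _; first exact: Dx.
rewrite [in leRHS]big_nat_recr //=.
set S := \sum_(1 <= k < _) _ in IHh *.
have {}IHh : K.+1%:R * h (average x K.+1) <= S.
  by rewrite mulrC -ler_pdivlMr ?ltr0n // mulrC.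
rewrite -[h _ in leLHS]mul1r -[in X in X * _ + _](mulVr K1) -mulrA -mulrDr.
rewrite ler_wpM2l ?invr_ge0 ?ler0n // KE; lra.
Qed.

End Convexity.

(** * First-order expansions along a set *)

Section Gradient.
Context {R : realType} {p : nat}.
Implicit Types (D : set 'cV[R]_p) (h : 'cV[R]_p -> R).
Implicit Types (x y g : 'cV[R]_p) (t : R).

(** Clearing the denominator makes the punctured neighborhood unnecessary: at
    [y = x] both sides are [0]. *)
Lemma is_gradientP D h x g : is_gradient D h x g <->
  forall e, 0 < e -> \forall y \near x,
    D y -> `|h y - h x - dot g (y - x)| <= e * norm2 (y - x).
Proof.
split=> [/cvgrPdist_le gh e e0|gh].
  have nearP : \forall y \near x, y != x -> D y ->
      `|0 - (h y - h x - dot g (y - x)) / norm2 (y - x)| <= e := gh e e0.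
  apply: filterS nearP => y + Dy; have [->|yx] := eqVneq y x => [_|/(_ isT Dy)].
    by rewrite !subrr dotC dot0l subr0 normr0 mulr_ge0 ?norm2_ge0 // ltW.
  have n0 : 0 < norm2 (y - x) by rewrite norm2_gt0 // subr_eq0.
  by rewrite sub0r normrN normrM normfV (gtr0_norm n0) ler_pdivrMr.
apply/cvgrPdist_le => e e0.
suff : \forall y \near x, y != x -> D y ->
    `|0 - (h y - h x - dot g (y - x)) / norm2 (y - x)| <= e by [].
apply: filterS (gh e e0) => y + yx Dy => /(_ Dy).
have n0 : 0 < norm2 (y - x) by rewrite norm2_gt0 // subr_eq0.
by rewrite sub0r normrN normrM normfV (gtr0_norm n0) ler_pdivrMr.
Qed.

(** A single arbitrarily small [t] is enough to compare slopes in [le_gradient]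
    and [gradient_le]; requiring [t <= e] lets it absorb second-order terms. *)
Lemma is_gradient_segment D h x y g e :
  convex_set D -> is_gradient D h x g -> D x -> D y -> 0 < e ->
  exists t, [/\ 0 < t, t <= 1, t <= e &
    `|h (x + t *: (y - x)) - h x - t * dot g (y - x)| <= e * t].
Proof.
move=> /convex_setP cD /is_gradientP gh Dx Dy e0.
set v := y - x.
(* The summand 1 keeps [b] positive when [v = 0]. *)
pose b := norm2 v + 1.
have b0 : 0 < b by rewrite ltr_wpDl ?norm2_ge0.
have := gh (e / b) (divr_gt0 e0 b0).
move=> /nbhs_ballP[r /= r0 near_r].
pose t := Num.min (Num.min 1 e) (r / b).
have t0 : 0 < t by rewrite !lt_min ltr01 e0 divr_gt0.
have [t1 te] : t <= 1 /\ t <= e by rewrite !ge_min !lexx !orbT.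
have tb : t * b <= r by rewrite -ler_pdivlMr // ge_min lexx orbT.
exists t; split=> //.
have zE : x + t *: v - x = t *: v by rewrite addrC addKr.
have nv : norm2 (t *: v) = t * norm2 v by rewrite norm2Z // ltW.
have := near_r (x + t *: v); rewrite /= zE nv dotZr => zP.
apply: le_trans (zP _ _) _.
- apply: ball_norm2; rewrite zE nv; apply: lt_le_trans tb.
  by rewrite ltr_pM2l // ltrDl.
- by apply: cD => //; rewrite (ltW t0).
- rewrite mulrAC ler_pdivrMr // -mulrA ler_wpM2l ?(ltW e0) //.
  by rewrite ler_wpM2l ?(ltW t0) // lerDl.
Qed.

(** The slack [q t^2] vanishes in the limit; through [gradient_le] it takes up
    the second-order terms of strong convexity. *)
Lemma le_gradient D h x y g c q :
  convex_set D -> is_gradient D h x g -> D x -> D y ->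
  (forall t, 0 < t <= 1 ->
     c * t - q * t ^+ 2 <= h (x + t *: (y - x)) - h x) ->
  c <= dot g (y - x).
Proof.
move=> cD gh Dx Dy lb; apply/ler_addgt0Pr => e e0.
pose q' := `|q| + 1; have q'0 : 0 < q' by rewrite ltr_wpDl.
(* The tolerance [e / (q' + 1)] covers both the expansion error, at most
   [tolerance * t], and the slack, at most [q' * tolerance * t]. *)
have [t [t0 t1 te]] :=
  is_gradient_segment cD gh Dx Dy (divr_gt0 e0 (addr_gt0 q'0 ltr01)).
rewrite ler_norml => /andP[_ ub].
have := lb t; rewrite t0 t1 => /(_ isT) {}lb.
rewrite -(ler_pM2r t0).
have qq : q <= q' by rewrite ler_wpDr // ler_norm.
move: te ub; set d := e / _ => te ub.
have dE : e = d * q' + d.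
  by rewrite -[X in _ + X]mulr1 -mulrDr divfK // gt_eqF // addr_gt0.
have qt : q * t ^+ 2 <= d * q' * t.
  rewrite expr2 mulrA ler_wpM2r ?(ltW t0) // mulrC.
  apply: le_trans (ler_wpM2l (ltW t0) qq) _.
  by rewrite ler_wpM2r ?(ltW q'0).
rewrite dE; lra.
Qed.

Lemma gradient_le D h x y g c q :
  convex_set D -> is_gradient D h x g -> D x -> D y ->
  (forall t, 0 < t <= 1 ->
     h (x + t *: (y - x)) - h x <= c * t + q * t ^+ 2) ->
  dot g (y - x) <= c.
Proof.
move=> cD gh Dx Dy ub; rewrite -lerN2 -dotNl.
apply: (@le_gradient D (fun z => - h z) x y (- g) (- c) q) => // [|t t01].
  apply/is_gradientP => e e0; have /is_gradientP/(_ e e0) := gh.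
  apply: filterS => z near_z Dz; rewrite dotNl -normrN.
  apply: le_trans (near_z Dz); rewrite le_eqVlt; apply/orP; left; apply/eqP.
  congr `|_|; lra.
have := ub t t01; lra.
Qed.

End Gradient.

(** * Bregman divergence and proximal steps *)

Section Bregman.
Context {R : realType} {p : nat}.
Implicit Types (D : set 'cV[R]_p) (h : 'cV[R]_p -> R).
Implicit Types (x y g : 'cV[R]_p) (t : R).

Definition differentiable_on D h :=
  forall x, D x -> exists g, is_gradient D h x g.

Lemma gradientP D h x : differentiable_on D h -> D x ->
  is_gradient D h x (gradient D h x).
Proof.
by move=> dh Dx; have [g gh] := dh x Dx; exact: (xgetPex 0 (ex_intro _ g gh)).
Qed.

(** Convexity of [h - 1/2 |.|^2] along the segment gives
    [h z - h x <= t (h y - h x - 1/2 |y - x|^2) + t^2/2 |y - x|^2] at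
    [z = x + t (y - x)]; only the term linear in [t] survives in the slope. *)
Lemma bregman_ge D h x y : convex_set D -> differentiable_on D h ->
  strongly_convex1 D h -> D x -> D y ->
  2^-1 * dot (y - x) (y - x) <= bregman D h y x.
Proof.
move=> cD dh /convex_functionP sh Dx Dy; rewrite /bregman.
move vE : (y - x) => v; pose b := dot v v.
have yE : y = x + v by rewrite -vE addrC subrK.
suff : dot (gradient D h x) v <= h y - h x - 2^-1 * b by rewrite /b; lra.
rewrite -{1}vE.
apply: (gradient_le (q := 2^-1 * b) cD (gradientP dh Dx)) => // t /andP[t0 t1].
have := sh x y t Dx Dy; rewrite (ltW t0) t1 => /(_ isT).
have -> : norm2 y ^+ 2 = dot x x + 2 * dot x v + b.
  by rewrite norm2_sq yE !dot_simp (dotC v x) -/b; ring.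
rewrite vE !norm2_sq !dot_simp (dotC v x) -/b.
move: (h _) (h y) (h x) (dot x x) (dot x v) b => *; lra.
Qed.

(** Along the segment from the minimizer [x1] to [z], optimality bounds the
    increments of [h] from below by a linear function of [t], since [f] is
    convex and the rest of the objective is affine. In the limit this is the
    variational inequality
    [a (f x1 - f z) - a <w, z - x1> + <g0, z - x1> <= <g1, z - x1>], with
    [g0], [g1] the gradients of [h] at [x] and [x1]; the inner products with
    [g0] and [g1] combine into the three divergences. *)
Lemma argmin_three_point D f h (a : R) (w x x1 z : 'cV[R]_p) :
  convex_set D -> convex_function D f -> differentiable_on D h -> 0 <= a ->
  D x1 -> D z ->
  is_argmin D (fun y => a * f y + a * dot w y + bregman D h y x) x1 ->
  a * f x1 + a * dot w x1 + bregman D h x1 x + bregman D h z x1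
    <= a * f z + a * dot w z + bregman D h z x.
Proof.
move=> cD cf dh a0 Dx1 Dz [_ opt]; rewrite /bregman; move vE : (z - x1) => v.
have zE : z = x1 + v by rewrite -vE addrC subrK.
set g0 := gradient D h x; set g1 := gradient D h x1.
have lb : a * (f x1 - f z) - a * dot w v + dot g0 v <= dot g1 v.
  rewrite -[v in X in _ <= X]vE.
  apply: (le_gradient (q := 0) cD (gradientP dh Dx1)) => // t /andP[t0 t1].
  have t01 : 0 <= t <= 1 by rewrite ltW.
  have Dzt : D (x1 + t *: v) by rewrite -vE; move/convex_setP: cD; apply.
  have /convex_functionP/(_ x1 z t Dx1 Dz t01) := cf.
  rewrite vE => /(ler_wpM2l a0).
  have := opt _ Dzt; rewrite /bregman -/g0 !dot_simp.
  move: (f _) (f z) (h _) (h x) => *; lra.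
have -> : dot w z = dot w x1 + dot w v by rewrite zE dotDr.
have -> : z - x = x1 - x + v by rewrite zE addrAC.
rewrite !(dotDr g0); lra.
Qed.

End Bregman.

(** * The primal-dual method with abstract operators *)

Section Method.
Context {R : realType} {P Q : nat}.
Context (X : set 'cV[R]_P) (f psi : 'cV[R]_P -> R).
Context (L : 'M[R]_P) (E : 'M[R]_(P, Q)).
Context (alpha : R) (xs : 'cV[R]_P) (us : 'cV[R]_Q).
Context (cX : convex_set X) (cf : convex_function X f)
  (dpsi : differentiable_on X psi) (spsi : strongly_convex1 X psi)
  (Lsym : L^T = L) (alpha_gt0 : 0 < alpha)
  (L_le : forall v, alpha * dot (L *m v) v <= dot v v)
  (L_ge : forall v, 2 * alpha * dot (E^T *m v) (E^T *m v) <= dot (L *m v) v)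
  (Exs : E^T *m xs = 0) (Lxs : L *m xs = 0) (Xxs : X xs).

Lemma dot_symL v w : dot (L *m v) w = dot (L *m w) v.
Proof. by rewrite dot_mulmx Lsym dotC. Qed.

Lemma L_psd v : 0 <= dot (L *m v) v.
Proof.
by apply: le_trans (L_ge v); rewrite mulr_ge0 ?dotxx_ge0 // mulr_ge0 // ltW.
Qed.

Let V := lyapunov X psi xs us.
Let gap z := ell f E us z - ell f E us xs + 4^-1 * dot (L *m z) z.

Lemma convex_gap : convex_function X gap.
Proof.
apply/convex_functionP => y z t Xy Xz t01; rewrite /gap /ell.
have /convex_functionP/(_ _ _ _ Xy Xz t01) := cf.
move vE : (z - y) => v; have zE : z = y + v by rewrite -vE addrC subrK.
have := L_psd v; case/andP: t01 => t0 t1.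
have -> : dot (L *m z) z = dot (L *m y) y + 2 * dot (L *m y) v + dot (L *m v) v.
  by rewrite [in LHS]zE mulmxDr !dot_simp (dot_symL v y); ring.
have -> : dot (E *m us) z = dot (E *m us) y + dot (E *m us) v.
  by rewrite [in LHS]zE dotDr.
rewrite mulmxDr -scalemxAr !dot_simp (dot_symL v y) => v0.
have : 0 <= t * (1 - t) * dot (L *m v) v.
  by rewrite !mulr_ge0 // subr_ge0.
move: (f _) (f z) (f y) (f xs) => *; lra.
Qed.

Lemma gap_descent x u x1 : X x -> X x1 ->
  is_argmin X (fun z => alpha * f z + alpha * dot (L *m x + E *m u) z
    + bregman X psi z x) x1 ->
  alpha * gap x1 <= V x u - V x1 (u + alpha *: (E^T *m x1)).
Proof.
move=> Xx Xx1 opt.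
(* The goal is a linear combination of these five inequalities. *)
have := argmin_three_point cX cf dpsi (ltW alpha_gt0) Xx1 Xxs opt.
have := bregman_ge cX dpsi spsi Xx Xx1.
have := ler_wpM2l (ltW alpha_gt0) (L_ge x1).
have := L_le (x1 - x).
have := ler_wpM2l (ltW alpha_gt0) (L_psd x).
rewrite /V /gap /lyapunov /ell !norm2_sq.
set y := E^T *m x1.
have EE (v : 'cV[R]_Q) z : dot (E *m v) z = dot v (E^T *m z).
  by rewrite dot_mulmx.
have -> : u + alpha *: y - us = (u - us) + alpha *: y by rewrite addrAC.
rewrite !dotDl !EE Exs (dot_symL x xs) Lxs -/y !mulmxDr mulmxN.
rewrite !dot_simp !dot0l !(dotC _ 0) !dot0l (dot_symL x x1).
rewrite (dotC us u) (dotC y u) (dotC y us).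
move: (f _) (f xs) (bregman _ _ _ _) (bregman _ _ _ _).
by move: (bregman _ _ _ _) => *; lra.
Qed.

Lemma primal_dual_rate (x : nat -> 'cV[R]_P) (u : nat -> 'cV[R]_Q) (K : nat) :
  is_trajectory X f psi L E alpha x u -> (1 <= K)%N ->
  gap (average x K) <= V (x 1%N) (u 1%N) / (alpha * K%:R).
Proof.
move=> traj K1.
have Xx k : (1 <= k)%N -> X (x k) by case/traj.
have K0 : 0 < K%:R :> R by rewrite ltr0n.
have V_ge0 k : (1 <= k)%N -> 0 <= V (x k) (u k).
  move=> k1; rewrite addr_ge0 // ?norm2_sq; last first.
    by rewrite mulr_ge0 ?invr_ge0 // dotxx_ge0.
  apply: le_trans (bregman_ge cX dpsi spsi (Xx k k1) Xxs).
  by rewrite mulr_ge0 ?invr_ge0 // dotxx_ge0.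
have [_ avg_le] := convex_average cX convex_gap (fun k _ => Xx k.+1 isT) K1.
apply: le_trans avg_le _.
rewrite invfM mulrA mulrC ler_wpM2r ?invr_ge0 ?(ltW K0) //.
rewrite ler_pdivlMr // mulrC mulr_sumr.
apply: le_trans
  (_ : \sum_(1 <= k < K.+1) (V (x k) (u k) - V (x k.+1) (u k.+1)) <= _).
  apply: ler_sum_nat => k /andP[k1 _]; have [Xxk opt ->] := traj k k1.
  exact: gap_descent (Xx k.+1 isT) opt.
rewrite (@telescope_sumr_eq _ _ _ (fun k => - V (x k) (u k)) _ (leqW K1)).
  by rewrite opprK addrC gerBl V_ge0.
by move=> k _; rewrite opprK addrC.
Qed.

End Method.

(** * Block vectors and separable functions *)

Section Blocks.
Context {R : realType}.

Lemma blockD N n (x y : 'cV[R]_(N * n)) i :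
  block (x + y) i = block x i + block y i.
Proof. by apply/colP => j; rewrite !mxE. Qed.

Lemma blockZ N n a (x : 'cV[R]_(N * n)) i : block (a *: x) i = a *: block x i.
Proof. by apply/colP => j; rewrite !mxE. Qed.

Lemma blockB N n (x y : 'cV[R]_(N * n)) i :
  block (x - y) i = block x i - block y i.
Proof. by apply/colP => j; rewrite !mxE. Qed.

Lemma sum_mxtens_index (V : nmodType) N n (F : 'I_(N * n) -> V) :
  \sum_k F k = \sum_(i < N) \sum_(j < n) F (mxtens_index (i, j)).
Proof.
rewrite pair_big /= (reindex (@mxtens_index N n)) /=; last first.
  exists (@mxtens_unindex N n) => k _; first exact: mxtens_indexK.
  exact: mxtens_unindexK.
by apply: eq_bigr => -[].
Qed.

Lemma dot_block N n (x y : 'cV[R]_(N * n)) :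
  dot x y = \sum_i dot (block x i) (block y i).
Proof.
rewrite dotE sum_mxtens_index; apply: eq_bigr => i _.
by rewrite dotE; apply: eq_bigr => j _; rewrite !mxE.
Qed.

Lemma block_tensmx1 M N n (A : 'M[R]_(M, N)) (x : 'cV[R]_(N * n)) i :
  block ((A *t (1%:M : 'M[R]_n)) *m x) i = \sum_k A i k *: block x k.
Proof.
apply/colP => j; rewrite !mxE sum_mxtens_index summxE; apply: eq_bigr => k _.
rewrite (bigD1 j) //= tensmxE mxE eqxx mulr1 !mxE big1 ?addr0 // => l lj.
by rewrite tensmxE mxE eq_sym (negbTE lj) mulr0 mul0r.
Qed.

Lemma norm2_block N n (x : 'cV[R]_(N * n)) i : norm2 (block x i) <= norm2 x.
Proof.
rewrite ler_wsqrtr // dot_block (bigD1 i) //= lerDl.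
by rewrite sumr_ge0 // => j _; rewrite dotxx_ge0.
Qed.

Context {N n : nat}.
Implicit Types (x : 'cV[R]_(N * n)).

Lemma convex_power_set (X0 : set 'cV[R]_n) :
  convex_set X0 -> convex_set (@power_set R N n X0).
Proof.
move=> /convex_setP cX0; apply/convex_setP => x y t Xx Xy t01 i.
by rewrite blockD blockZ blockB; apply: cX0.
Qed.

Lemma convex_separable_sum (X0 : set 'cV[R]_n) (f : 'I_N -> 'cV[R]_n -> R) :
  (forall i, convex_function X0 (f i)) ->
  convex_function (power_set X0) (separable_sum f).
Proof.
move=> cf; apply/convex_functionP => x y t Xx Xy t01.
rewrite /separable_sum -sumrB mulr_sumr -big_split /=; apply: ler_sum => i _.
rewrite blockD blockZ blockB.
by have /convex_functionP := cf i; apply.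
Qed.

Lemma strongly_convex_separable_sum (X0 : set 'cV[R]_n)
    (f : 'I_N -> 'cV[R]_n -> R) :
  (forall i, strongly_convex1 X0 (f i)) ->
  strongly_convex1 (power_set X0) (separable_sum f).
Proof.
move=> /convex_separable_sum; rewrite /strongly_convex1; congr convex_function.
apply/funext => x; rewrite norm2_sq dot_block mulr_sumr /separable_sum -sumrB.
by apply: eq_bigr => i _; rewrite norm2_sq.
Qed.

Lemma near_block (x : 'cV[R]_(N * n)) i (A : set 'cV[R]_n) :
  nbhs (block x i) A -> \forall y \near x, A (block y i).
Proof.
move=> /nbhs_ballP[r /= r0 rA]; apply/nbhs_ballP; exists r => //= y [_ xy].
by apply: rA; split=> // j k; rewrite !mxE; exact: xy.
Qed.

(** The gradients of the components, stacked. Each of the [N] expansion errors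
    is allowed a share of about [e / N], since a block of [y - x] is no longer
    than [y - x]. *)
Lemma differentiable_separable_sum (X0 : set 'cV[R]_n)
    (f : 'I_N -> 'cV[R]_n -> R) :
  (forall i, differentiable_on X0 (f i)) ->
  differentiable_on (power_set X0) (separable_sum f).
Proof.
move=> df x Xx.
have /choice[g gP] : forall i, exists g, is_gradient X0 (f i) (block x i) g.
  by move=> i; exact: df.
pose gx : 'cV[R]_(N * n) := \col_k g (mxtens_unindex k).1 (mxtens_unindex k).2 0.
have gxE i : block gx i = g i.
  by apply/colP => j; rewrite !mxE mxtens_indexK.
exists gx; apply/is_gradientP => e e0.
(* [N.+1] instead of [N] avoids a division by zero when [N = 0]. *)
pose e' := e / N.+1%:R; have e'0 : 0 < e' by rewrite divr_gt0 ?ltr0n.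
have near_i i : \forall y \near x, X0 (block y i) ->
    `|f i (block y i) - f i (block x i) - dot (g i) (block y i - block x i)|
      <= e' * norm2 (block y i - block x i).
  by have /is_gradientP/(_ e' e'0)/near_block := gP i.
apply: filterS (filter_forall _ near_i) => y near_y Xy.
rewrite dot_block /separable_sum -!sumrB.
apply: le_trans (ler_norm_sum _ _ _) _.
apply: (@le_trans _ _ (\sum_(i < N) e' * norm2 (y - x))).
  apply: ler_sum => i _; rewrite gxE blockB; apply: le_trans (near_y i (Xy i)) _.
  by rewrite ler_wpM2l ?(ltW e'0) // -blockB norm2_block.
rewrite sumr_const card_ord -[_ *+ _]mulr_natr mulrAC ler_wpM2r ?norm2_ge0 //.
rewrite /e' mulrAC ler_pdivrMr ?ltr0n // ler_wpM2l ?(ltW e0) //.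
by rewrite ler_nat.
Qed.

End Blocks.

(** * An eigenvalue bounding the Rayleigh quotient *)

Section Rayleigh.
Context {R : realType} {p : nat}.
Implicit Types (A B : 'M[R]_p) (v : 'cV[R]_p).

Lemma dot_mulmx_bound A : exists2 c : R, 0 < c &
  forall v, dot (A *m v) (A *m v) <= c * dot v v.
Proof.
pose r i := \sum_j `|A i j|.
have r0 i : 0 <= r i by rewrite sumr_ge0.
exists (1 + \sum_i r i ^+ 2) => [|v].
  by rewrite ltr_pwDl // sumr_ge0 // => i _; rewrite sqr_ge0.
apply: (@le_trans _ _ ((\sum_i r i ^+ 2) * dot v v)); last first.
  by rewrite ler_wpM2r ?dotxx_ge0 // lerDr.
rewrite [leLHS]dotE mulr_suml; apply: ler_sum => i _.
rewrite -expr2 -norm2_sq -exprMn -ler_sqrt ?sqr_ge0 // !sqrtr_sqr.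
rewrite (ger0_norm (mulr_ge0 (r0 i) (norm2_ge0 v))) mxE mulr_suml.
apply: le_trans (ler_norm_sum _ _ _) _; apply: ler_sum => j _.
by rewrite normrM ler_wpM2l // le_coord_norm2.
Qed.

(** A positive semidefinite form is small only where [B v] is small. This comes
    from its nonnegativity at [v - c^-1 B v], the result of a gradient step of
    length [c^-1] from [v]. *)
Lemma psd_mulmx_bound B (c : R) v : B^T = B -> 0 < c ->
  (forall w, 0 <= dot (B *m w) w) ->
  (forall w, dot (B *m w) w <= c * dot w w) ->
  dot (B *m v) (B *m v) <= c * dot (B *m v) v.
Proof.
move=> Bsym c0 B0 Bc; set w := B *m v.
have Bww := Bc w; have := B0 (v - c^-1 *: w).
rewrite mulmxBr -scalemxAr -/w !dot_simp.
have -> : dot (B *m w) v = dot w w by rewrite dot_mulmx Bsym.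
have : c^-1 * c^-1 * dot (B *m w) w <= c^-1 * dot w w.
  by rewrite -mulrA ler_pM2l ?invr_gt0 // mulrC ler_pdivrMr // mulrC.
move=> le1 le2; rewrite mulrC -ler_pdivrMr // mulrC; lra.
Qed.

(** With [mu] the supremum of the Rayleigh quotient, [B = mu - A] is positive
    semidefinite. If it were invertible, then [|v|^2] would be bounded by a
    multiple of [|B v|^2], hence of [<B v, v>] by [psd_mulmx_bound], so that the
    quotient would stay away from [mu]. The vector [z] excludes dimension zero,
    where there is no eigenvalue. *)
Lemma rayleigh_eigenvalue A (z : 'cV[R]_p) : A^T = A -> z != 0 ->
  exists2 mu : R, eigenvalue A mu & forall v, dot (A *m v) v <= mu * dot v v.
Proof.
move=> Asym z0.
have [c c0 Ac] := dot_mulmx_bound A.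
have Ac' v : dot (A *m v) v <= 2^-1 * (c + 1) * dot v v.
  have := dotxx_ge0 (A *m v - v); have := Ac v.
  by rewrite !dot_simp (dotC v); lra.
pose S := [set r | exists2 v, v != 0 & r = dot (A *m v) v / dot v v].
have Sub : ubound S (2^-1 * (c + 1)).
  by move=> _ [v v0 ->]; rewrite ler_pdivrMr ?dotxx_gt0.
have Ssup : has_sup S.
  by split; [exists (dot (A *m z) z / dot z z); exists z
            |exists (2^-1 * (c + 1))].
pose mu := sup S.
have Amu v : dot (A *m v) v <= mu * dot v v.
  have [->|v0] := eqVneq v 0; first by rewrite mulmx0 !dot0l mulr0.
  by rewrite -ler_pdivrMr ?dotxx_gt0 //; apply: sup_upper_bound => //; exists v.
exists mu => //.
pose B := mu%:M - A.
have BE v : dot (B *m v) v = mu * dot v v - dot (A *m v) v.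
  by rewrite mulmxBl mul_scalar_mx !dot_simp.
have Bsym : B^T = B by rewrite linearB /= tr_scalar_mx Asym.
have [c1 c10 Bc1] := dot_mulmx_bound B.
have [c2 c20 Bc2] := dot_mulmx_bound (invmx B).
rewrite /eigenvalue /eigenspace kermx_eq0 row_free_unit.
apply/negP => Aunit.
have Bunit : B \in unitmx.
  by rewrite -[B]opprK opprB -scaleN1r unitmxZ // unitfE oppr_eq0 oner_eq0.
(* [<B w, w> <= 1/2 (|B w|^2 + |w|^2)], whence the constant [c3]. *)
pose c3 := 2^-1 * (c1 + 1).
have c30 : 0 < c3 by rewrite mulr_gt0 ?invr_gt0 // addr_gt0.
have Bpos v : dot v v <= c2 * c3 * dot (B *m v) v.
  have := Bc2 (B *m v); rewrite mulKmx // => /le_trans; apply.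
  rewrite -mulrA ler_pM2l //; apply: psd_mulmx_bound => // w.
    by rewrite BE subr_ge0.
  have := dotxx_ge0 (B *m w - w); have := Bc1 w.
  by rewrite !dot_simp (dotC w) /c3; lra.
have e0 : 0 < (c2 * c3)^-1 by rewrite invr_gt0 mulr_gt0.
have [_ [v v0 ->]] := sup_adherent e0 Ssup.
rewrite -/mu ltr_pdivlMr ?dotxx_gt0 //.
have := Bpos v; rewrite BE [leRHS]mulrC -ler_pdivrMr ?mulr_gt0 //; lra.
Qed.

End Rayleigh.

(** * Weighted graph operators *)

Lemma block_diag {R : realType} {m n : nat} (a : 'rV[R]_m)
    (y : 'cV[R]_(m * n)) k :
  block ((diag_mx a *t (1%:M : 'M[R]_n)) *m y) k = a 0 k *: block y k.
Proof.
rewrite block_tensmx1 (bigD1 k) //= mxE eqxx mulr1n big1 ?addr0 // => l lk.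
by rewrite mxE eq_sym (negbTE lk) mulr0n scale0r.
Qed.

Section GraphOperators.
Context {R : realType} {N : nat} {G : sgraph N}.
Context {head : {set 'I_N} -> 'I_N} {n : nat}.
Context {s d : 'rV[R]_#|edges G|}.
Context (s_gt0 : forall e, 0 < s 0 e) (d_gt0 : forall e, 0 < d 0 e).

Local Notation E := (Es head n s).
Local Notation L := (Ld head n d).

(** Everything needed about [L] in relation to [E] is read off from this
    factorization through a diagonal matrix. *)
Lemma Ld_factor :
  L = E *m (diag_mx (\row_k (d 0 k / s 0 k)) *t (1%:M : 'M[R]_n)) *m E^T.
Proof.
rewrite /Ld /Es trmx_tens trmx1 !tensmx_mul !mulmx1; congr (_ *t _).
rewrite trmx_mul tr_diag_mx !mulmxA; congr (_ *m _); rewrite -!mulmxA.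
congr (_ *m _); rewrite !mulmx_diag; congr diag_mx; apply/rowP => k.
rewrite !mxE -{2}[s 0 k]sqr_sqrtr ?(ltW (s_gt0 k)) //; field.
by rewrite gt_eqF // sqrtr_gt0.
Qed.

Lemma Ld_sym : L^T = L.
Proof. by rewrite Ld_factor !trmx_mul trmxK trmx_tens tr_diag_mx trmx1 mulmxA. Qed.

Lemma Ld_ker (v : 'cV[R]_(N * n)) : E^T *m v = 0 -> L *m v = 0.
Proof. by rewrite Ld_factor -mulmxA => ->; rewrite mulmx0. Qed.

Lemma Ld_ge (c : R) (v : 'cV[R]_(N * n)) : (forall e, c * s 0 e - d 0 e <= 0) ->
  c * dot (E^T *m v) (E^T *m v) <= dot (L *m v) v.
Proof.
move=> cs; rewrite Ld_factor -!mulmxA (dot_mulmx E).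
rewrite !dot_block mulr_sumr; apply: ler_sum => k _.
rewrite block_diag dotZl ler_wpM2r ?dotxx_ge0 // mxE ler_pdivlMr //.
by rewrite -subr_le0.
Qed.

(** The largest [a] with [a s <= d] is at least the smallest ratio [d/s], which
    is positive. Without edges every real number qualifies, and there is no
    largest one. *)
Lemma max_ratio_gt0 (c : R) :
  is_max [set a : R | forall e, a * s 0 e - d 0 e <= 0] c ->
  (0 < #|edges G|)%N /\ 0 < c.
Proof.
move=> [_ c_ub].
have G0 : (0 < #|edges G|)%N.
  rewrite lt0n; apply/negP => /eqP G0.
  have : c + 1 <= c.
    by apply: c_ub => e; have := ltn_ord e; rewrite [X in (_ < X)%N]G0.
  by rewrite gerDl ler10.
split=> //; pose r k := d 0 k / s 0 k.
case: (@Order.TotalTheory.arg_minP _ _ _ (Ordinal G0) xpredT r) => // k _ r_min.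
apply: (@lt_le_trans _ _ (r k)); first exact: divr_gt0.
by apply: c_ub => e /=; rewrite subr_le0 -ler_pdivlMr //; exact: r_min.
Qed.

Lemma Es_neq0 : (0 < #|edges G|)%N -> (0 < n)%N ->
  exists v : 'cV[R]_(N * n), E^T *m v != 0.
Proof.
move=> G0 n0; pose k := Ordinal G0; pose j := Ordinal n0.
(* A unit vector at the head of an edge, where the incidence entry is 1. *)
exists (delta_mx (mxtens_index (head (enum_val k), j)) 0).
rewrite -colE; apply/eqP => /colP/(_ (mxtens_index (k, j))).
rewrite [LHS]mxE [LHS]mxE /Es tensmxE mul_mx_diag !mxE eqxx /=.
by rewrite eqxx mul1r mulr1 => /eqP; rewrite sqrtr_eq0 leNgt s_gt0.
Qed.

(** The eigenvalue of [rayleigh_eigenvalue] is at most [lambda], and it is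
    positive as soon as the form of [L] takes a positive value. *)
Lemma Ld_le (lambda : R) :
  is_max [set a : R | eigenvalue L a] lambda ->
  (exists v : 'cV[R]_(N * n), 0 < dot (L *m v) v) ->
  0 < lambda /\ forall v : 'cV[R]_(N * n), dot (L *m v) v <= lambda * dot v v.
Proof.
move=> [_ ub] [z Lz].
have z0 : z != 0 by apply: contraTneq Lz => ->; rewrite mulmx0 dot0l ltxx.
have [mu /ub mu_le Lmu] := rayleigh_eigenvalue Ld_sym z0.
split=> [|v]; last first.
  by apply: le_trans (Lmu v) _; rewrite ler_wpM2r ?dotxx_ge0.
apply: lt_le_trans mu_le; rewrite -(pmulr_lgt0 _ (dotxx_gt0 z0)).
exact: lt_le_trans Lz (Lmu z).
Qed.

End GraphOperators.

(** * The ergodic rate *)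

Theorem theorem2 (R : realType) (N n : nat)
  (G : sgraph N) (head : {set 'I_N} -> 'I_N)
  (hconn : connected_graph G) (hhead : is_orientation G head)
  (s d : 'rV[R]_#|edges G|)
  (hs : forall e, 0 < s 0 e) (hd : forall e, 0 < d 0 e)
  (gamma lambda : R)
  (hgamma : is_max [set a : R | forall e, a * s 0 e - d 0 e <= 0] gamma^-1)
  (hlambda : is_max [set a : R | eigenvalue (Ld head n d) a] lambda)
  (X0 : set 'cV[R]_n) (hX0cl : closed X0) (hX0cv : convex_set X0)
  (psi0 : 'cV[R]_n -> R)
  (hpsi0 : continuously_differentiable X0 psi0)
  (hpsi0cv : strongly_convex1 X0 psi0)
  (f_ : 'I_N -> 'cV[R]_n -> R)
  (hf_ : forall i, proper_closed_convex X0 (f_ i)) :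
  let X : set 'cV[R]_(N * n) := power_set X0 in
  let f := separable_sum f_ in
  let psi := separable_sum (fun _ : 'I_N => psi0) in
  let E := Es head n s in
  let L := Ld head n d in
  forall (xs : 'cV[R]_(N * n)) (us : 'cV[R]_(#|edges G| * n))
    (gs : 'cV[R]_(N * n)),
  subdifferential X f xs gs ->
  E^T *m xs = 0 ->
  X xs ->
  normal_cone X xs (- gs - E *m us) ->
  let alpha := Num.min lambda^-1 (2 * gamma)^-1 in
  forall (x : nat -> 'cV[R]_(N * n)) (u : nat -> 'cV[R]_(#|edges G| * n)),
  is_trajectory X f psi L E alpha x u ->
  forall K : nat, (1 <= K)%N ->
  let xbar := average x K in
  ell f E us xbar - ell f E us xs + 4^-1 * dot (L *m xbar) xbar
    <= lyapunov X psi xs us (x 1%N) (u 1%N) / (alpha * K%:R).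
Proof.
move=> X f psi E L xs us gs _ Exs Xxs _ alpha x u traj K K1; lazy zeta.
have [G0 c0] := max_ratio_gt0 hs hd hgamma.
have cs : forall e, gamma^-1 * s 0 e - d 0 e <= 0 by case: hgamma.
(* In dimension zero [L] has no eigenvalue at all. *)
have n0 : (0 < n)%N.
  rewrite lt0n; apply/negP => /eqP n0; case: hlambda => + _.
  move=> /eigenvalueP[v _ /eqP]; apply; apply/rowP => -[k kN].
  by exfalso; move: kN; rewrite n0 muln0.
have [l0 L_le] : 0 < lambda /\
    forall v : 'cV[R]_(N * n), dot (L *m v) v <= lambda * dot v v.
  apply: (Ld_le hs hlambda); have [v Ev] := Es_neq0 (head := head) hs G0 n0.
  exists v; apply: lt_le_trans _ (Ld_ge hs v cs).
  by rewrite mulr_gt0 // dotxx_gt0.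
have g0 : 0 < gamma by rewrite -invr_gt0.
have alpha0 : 0 < alpha by rewrite lt_min !invr_gt0 l0 mulr_gt0.
have alpha_l : alpha * lambda <= 1.
  by rewrite -ler_pdivlMr // div1r ge_min lexx.
have alpha_c : 2 * alpha <= gamma^-1.
  by rewrite mulrC -ler_pdivlMr // mulrC -invfM ge_min lexx orbT.
apply: primal_dual_rate traj K1 => //.
- exact: convex_power_set.
- by apply: convex_separable_sum => i; case: (hf_ i).
- apply: differentiable_separable_sum => _ z X0z.
  by have [g [gP _]] := hpsi0; exists (g z); exact: gP.
- exact: strongly_convex_separable_sum.
- exact: Ld_sym hs.
- move=> v; apply: le_trans (ler_wpM2l (ltW alpha0) (L_le v)) _.
  by rewrite mulrA ler_piMl // dotxx_ge0.
- move=> v; apply: le_trans _ (Ld_ge hs v cs).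
  by rewrite ler_wpM2r // dotxx_ge0.
- exact: (Ld_ker (head := head) (d := d) hs Exs).
Qed.
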